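(* Let $0<\mu<L$ and let $f:\mathbb{R}^d\to\mathbb{R}$ be $\mu$-strongly convex and $L$-smooth. Consider minimizing $f$ with Nesterov's accelerated gradient method (NAG) with gradient errors $w_k\in\mathbb{R}^d$, $$x_{k+1}=x_k-\alpha(\nabla f(y_k)+w_k)+\beta(x_k-x_{k-1}),\qquad y_k=x_k+\beta(x_k-x_{k-1}),\quad k\ge0,$$ with constant stepsize $\alpha\in(0,1/L]$, $\beta=\frac{1-\sqrt{\alpha\mu}}{1+\sqrt{\alpha\mu}}$ and initialization $x_0=x_{-1}\in\mathbb{R}^d$. Then for every $K\ge0$ the ergodic average $\bar x_K=\frac{1}{K+1}\sum_{j=0}^Kx_j$ satisfies $$f(\bar x_K)-f(x_* )\le\frac{1}{K+1}\sum_{j=0}^K[f(x_j)-f(x_* )]\le\big(\overline{L}_{NAG}(\alpha)\big)^2\frac{\sum_{j=0}^K\|w_j\|^2}{K+1}+\frac{\overline H(x_0)}{K+1}-\frac{2}{\sqrt{\alpha\mu}}\frac{f(x_{K+1})-f(x_* )}{K+1},$$ where $$\overline H(x_0)=\frac{2}{\sqrt{\alpha\mu}}\bigg(1+\frac{\sqrt{\alpha\mu}(1-\sqrt{\alpha\mu})}{4(5-2\sqrt{\alpha\mu}+\alpha\mu)}+\frac{\sqrt{\alpha\mu}(1-\sqrt{\alpha\mu})^2}{4(4+(1-\sqrt{\alpha\mu})^2)}\bigg)V_0.$$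
   Context: $L$-smooth means $f$ is continuously differentiable with $L$-Lipschitz gradient; $\mu$-strongly convex means $x\mapsto f(x)-\frac\mu2\|x\|^2$ is convex. $x_*$ is the minimizer of $f$. $$\overline{L}_{NAG}(\alpha):=\sqrt{\frac{4(5-2\sqrt{\alpha\mu}+\alpha\mu)}{\mu(1+\sqrt{\alpha\mu})^2}+\frac{\sqrt\alpha(1+\alpha L)}{\sqrt\mu}+\frac{8\alpha^3L^4\big(4+(1-\sqrt{\alpha\mu})^2\big)}{\mu^2(1+\sqrt{\alpha\mu})^2}}.$$ $V_0$ is the initial value of the Lyapunov function: $$V_0=f(x_0)-f(x_* )+\begin{bmatrix}x_0-x_*\\ x_{-1}-x_*\end{bmatrix}^T(\tilde P\otimes I_d)\begin{bmatrix}x_0-x_*\\ x_{-1}-x_*\end{bmatrix},\quad\tilde P=\frac{1}{2\alpha}\begin{bmatrix}1\\ -(1-\sqrt{\alpha\mu})\end{bmatrix}\begin{bmatrix}1&-(1-\sqrt{\alpha\mu})\end{bmatrix}.$$ *)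

(* Defs.v *)
From HB Require Import structures.
From mathcomp Require Export all_boot all_order all_algebra.
From mathcomp Require Export all_classical all_reals all_analysis.
From mathcomp.real_closed Require Export mxtens.

Set Implicit Arguments.
Unset Strict Implicit.
Unset Printing Implicit Defensive.

Export Order.TTheory GRing.Theory Num.Theory.
Export numFieldNormedType.Exports.

Local Open Scope classical_set_scope.
Local Open Scope ring_scope.

(* The library norm `|x| on matrices is the sup norm; the mathematics below is
   about the Euclidean norm.  Topology and differentiability are the same for
   both. *)
Definition enorm (R : realType) (d : nat) (x : 'cV[R]_d) : R :=
  Num.sqrt (\sum_(i < d) x i 0 ^+ 2).

Definition grad (R : realType) (d : nat) (f : 'cV[R]_d -> R) (x : 'cV[R]_d) :
    'cV[R]_d :=
  \col_(i < d) 'D_(delta_mx i 0) f x.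

Definition smooth (R : realType) (d : nat) (L : R) (f : 'cV[R]_d -> R) : Prop :=
  [/\ forall x, differentiable f x,
      continuous (grad f)
    & forall x y, enorm (grad f x - grad f y) <= L * enorm (x - y)].

Definition strongly_convex (R : realType) (d : nat) (mu : R)
    (f : 'cV[R]_d -> R) : Prop :=
  @convex_function R 'cV[R]_d setT (fun x => f x - mu / 2 * enorm x ^+ 2).

Definition minimizer (R : realType) (d : nat) (f : 'cV[R]_d -> R)
    (xs : 'cV[R]_d) : Prop :=
  forall z, f xs <= f z.

(* The iterates are indexed by int so that x (-1) is available. *)
Definition noisy_nag (R : realType) (d : nat) (f : 'cV[R]_d -> R)
    (alpha beta : R) (w : nat -> 'cV[R]_d) (x : int -> 'cV[R]_d) : Prop :=
  forall k : nat,
    let y := x k%:Z + beta *: (x k%:Z - x (k%:Z - 1)) in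
    x (k%:Z + 1) =
      x k%:Z - alpha *: (grad f y + w k) + beta *: (x k%:Z - x (k%:Z - 1)).

Definition nag_beta (R : realType) (mu alpha : R) : R :=
  let s := Num.sqrt (alpha * mu) in (1 - s) / (1 + s).

Definition Lbar_NAG (R : realType) (mu L alpha : R) : R :=
  let s := Num.sqrt (alpha * mu) in
  Num.sqrt
    (4 * (5 - 2 * s + alpha * mu) / (mu * (1 + s) ^+ 2)
     + Num.sqrt alpha * (1 + alpha * L) / Num.sqrt mu
     + 8 * alpha ^+ 3 * L ^+ 4 * (4 + (1 - s) ^+ 2)
       / (mu ^+ 2 * (1 + s) ^+ 2)).

Definition Ptilde (R : realType) (mu alpha : R) : 'M[R]_2 :=
  let p : 'cV[R]_2 :=
    \col_(i < 2) (if i == 0 then 1 else - (1 - Num.sqrt (alpha * mu))) in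
  (2 * alpha)^-1 *: (p *m p^T).

(* [u; v] in R^{2d}; the cast adjusts col_mx's dimension d + d to the 2 * d of
   the Kronecker product [tensmx]. *)
Definition stack (R : realType) (d : nat) (u v : 'cV[R]_d) : 'cV[R]_(2 * d) :=
  castmx (etrans (addnn d) (esym (mul2n d)), erefl 1) (col_mx u v).

Definition lyapunov (R : realType) (d : nat) (f : 'cV[R]_d -> R)
    (xs : 'cV[R]_d) (mu alpha : R) (x0 xm1 : 'cV[R]_d) : R :=
  let z := stack (x0 - xs) (xm1 - xs) in
  f x0 - f xs
  + (z^T *m tensmx (Ptilde mu alpha) (1%:M : 'M[R]_d) *m z) 0 0.

Definition Hbar (R : realType) (mu alpha V0 : R) : R :=
  let s := Num.sqrt (alpha * mu) in
  2 / s
  * (1 + s * (1 - s) / (4 * (5 - 2 * s + alpha * mu))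
       + s * (1 - s) ^+ 2 / (4 * (4 + (1 - s) ^+ 2)))
  * V0.

Definition ergodic_avg (R : realType) (d : nat) (x : int -> 'cV[R]_d)
    (K : nat) : 'cV[R]_d :=
  (K.+1%:R)^-1 *: \sum_(j < K.+1) x j%:Z.

(* Main.v *)
Require Import Defs.
From mathcomp Require Import ring lra.

Set Implicit Arguments.
Unset Strict Implicit.
Unset Printing Implicit Defensive.

Local Open Scope classical_set_scope.
Local Open Scope ring_scope.

(** Write s = sqrt (alpha mu), so that 0 < s <= 1 and mu = s^2 / alpha.

    The Lyapunov function at step k is
      V_k = f x_k - f xs + |p_k|^2 / (2 alpha),
      p_k = x_k - xs - (1 - s) (x_{k-1} - xs).
    Without noise it contracts by the factor 1 - s: the descent inequality at
    y_k, combined with the two strong convexity inequalities at y_k towards x_k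
    (weight 1 - s) and towards xs (weight s), makes all quadratic terms cancel
    up to a favourable sign.  With noise the same computation leaves
      - <q, w> + alpha^2 L <g, w> + alpha (1 + alpha L) / 2 |w|^2
    on the right-hand side, where g is the gradient at y_k and q is the value
    that p_{k+1} would have without the gradient step
    ([nag_step_expansion]).

    Half of the contraction is sacrificed to absorb the two cross terms.  With
    e = x_k - xs, both q and y_k - xs are explicit combinations of p_k and e:
      (1 + s) q = p_k + s^2 e,      (1 + s) (y_k - xs) = p_k + e,
    while |g| <= L |y_k - xs| and, by quadratic growth, V_k dominates
    (|p_k|^2 + s^2 |e|^2) / (2 alpha).  Young's inequality then bounds the cross
    terms by s/2 V_k plus a multiple of |w|^2 ([noise_bound]); that multiple is
    at most s/2 times the square of Lbar_NAG ([noise_coefficient_le]).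
    Altogether ([nag_lyapunov_step])
      V_{k+1} <= (1 - s/2) V_k + s/2 Lbar_NAG^2 |w_k|^2.

    Summing over k bounds s/2 times the sum of the V_k by
    V_0 - V_{K+1} plus the accumulated noise ([sum_perturbed_contraction]).
    Since f x_k - f xs <= V_k, dividing by s/2 gives the second inequality, the
    constant in Hbar being at least 2 / s.  The first inequality is Jensen's. *)

(** * Euclidean inner product *)

Definition dot (R : realType) (d : nat) (u v : 'cV[R]_d) : R :=
  \sum_(i < d) u i 0 * v i 0.

Lemma dotC (R : realType) d (u v : 'cV[R]_d) : dot u v = dot v u.
Proof. by apply: eq_bigr => i _; rewrite mulrC. Qed.

Lemma dotDl (R : realType) d (u v w : 'cV[R]_d) :
  dot (u + v) w = dot u w + dot v w.
Proof. by rewrite -big_split; apply: eq_bigr => i _; rewrite mxE mulrDl. Qed.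

Lemma dotZl (R : realType) d (a : R) (u v : 'cV[R]_d) :
  dot (a *: u) v = a * dot u v.
Proof. by rewrite mulr_sumr; apply: eq_bigr => i _; rewrite mxE mulrA. Qed.

Lemma dotNl (R : realType) d (u v : 'cV[R]_d) : dot (- u) v = - dot u v.
Proof. by rewrite -scaleN1r dotZl mulN1r. Qed.

Lemma dotDr (R : realType) d (u v w : 'cV[R]_d) :
  dot w (u + v) = dot w u + dot w v.
Proof. by rewrite dotC dotDl !(dotC w). Qed.

Lemma dotZr (R : realType) d (a : R) (u v : 'cV[R]_d) :
  dot v (a *: u) = a * dot v u.
Proof. by rewrite dotC dotZl dotC. Qed.

Lemma dotNr (R : realType) d (u v : 'cV[R]_d) : dot v (- u) = - dot v u.
Proof. by rewrite dotC dotNl dotC. Qed.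

Definition dotE := (dotDl, dotDr, dotZl, dotZr, dotNl, dotNr).

Lemma dot_ge0 (R : realType) d (u : 'cV[R]_d) : 0 <= dot u u.
Proof. by apply: sumr_ge0 => i _; rewrite -expr2 sqr_ge0. Qed.

Lemma dot_eq0 (R : realType) d (u : 'cV[R]_d) : dot u u = 0 -> u = 0.
Proof.
move=> /eqP; rewrite psumr_eq0 => [/allP u0|i _]; last by rewrite -expr2 sqr_ge0.
apply/colP => i; rewrite mxE; apply/eqP.
by have := u0 i (mem_index_enum i); rewrite mulf_eq0 orbb.
Qed.

Lemma enorm_sqr (R : realType) d (u : 'cV[R]_d) : enorm u ^+ 2 = dot u u.
Proof.
rewrite sqr_sqrtr; first by apply: eq_bigr => i _; rewrite expr2.
by apply: sumr_ge0 => i _; rewrite sqr_ge0.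
Qed.

(** Nonnegativity of the square of u - v / (2 c). *)
Lemma dot_young (R : realType) d (c : R) (u v : 'cV[R]_d) : 0 < c ->
  dot u v <= c * dot u u + dot v v / (4 * c).
Proof.
move=> c0; rewrite -subr_ge0.
have := dot_ge0 (u - (2 * c)^-1 *: v).
have -> : c * dot u u + dot v v / (4 * c) - dot u v
    = c * dot (u - (2 * c)^-1 *: v) (u - (2 * c)^-1 *: v).
  by rewrite !dotE (dotC v u); field; lra.
by move=> ?; rewrite mulr_ge0 // ltW.
Qed.

(** Young's inequality on the cross term, with a free weight t to match the
    ratio in which |p|^2 and |e|^2 are available. *)
Lemma dot_lincomb_le (R : realType) d (c t : R) (p e : 'cV[R]_d) : 0 < t ->
  dot (p + c *: e) (p + c *: e) <= (1 + t) * dot p p + (1 + t^-1) * c ^+ 2 * dot e e.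
Proof.
move=> t0; have := dot_young p (c *: e) (c := t / 2).
rewrite divr_gt0 // => /(_ isT); rewrite !dotE (dotC e p).
have -> : c * (c * dot e e) / (4 * (t / 2)) = t^-1 * c ^+ 2 * dot e e / 2 by field; lra.
lra.
Qed.

(** * First-order inequalities for smooth strongly convex functions *)

(** Partial derivatives determine all directional ones because f is
    differentiable: the differential is linear, hence fixed by its values on the
    canonical basis. *)
Lemma dot_grad (R : realType) d (f : 'cV[R]_d -> R) (x v : 'cV[R]_d) :
  differentiable f x -> dot (grad f x) v = 'D_v f x.
Proof.
move=> df; rewrite deriveE //.
have -> : v = \sum_(i < d) v i 0 *: delta_mx i 0.
  apply/colP => i; rewrite summxE (bigD1 i) //= !mxE !eqxx mulr1 big1 ?addr0 //.
  by move=> j ji; rewrite !mxE eq_sym (negbTE ji) mulr0.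
rewrite linear_sum /dot; apply: eq_bigr => i _.
rewrite linearZ /= !mxE deriveE //= mulrC; congr (_ * _).
rewrite summxE (bigD1 i) //= !mxE !eqxx mulr1 big1 ?addr0 //.
by move=> j ji; rewrite !mxE eq_sym (negbTE ji) mulr0.
Qed.

(** The difference quotient of the restriction of f to a line is, up to
    rewriting, the one that defines the directional derivative. *)
Lemma is_derive_line (R : realType) d (f : 'cV[R]_d -> R) (y v : 'cV[R]_d)
    (t : R) : differentiable f (y + t *: v) ->
  is_derive t 1 (fun r => f (y + r *: v)) (dot (grad f (y + t *: v)) v).
Proof.
move=> df.
have quot : (fun h : R => h^-1 *: (((fun r => f (y + r *: v)) \o shift t) (h *: 1)
     - f (y + t *: v)))
  = (fun h : R => h^-1 *: ((f \o shift (y + t *: v)) (h *: v) - f (y + t *: v))).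
  apply/funext => h /=; congr (_ *: (f _ - _)).
  by rewrite -[h *: 1]/(h * 1) mulr1 scalerDl addrCA.
apply: DeriveDef; first by rewrite /derivable quot; exact: diff_derivable.
by rewrite /derive quot dot_grad.
Qed.

(** The classical form of strong convexity: the quadratic that is subtracted in
    the definition contributes mu / 2 t (1 - t) |x - y|^2. *)
Lemma strongly_convex_segment (R : realType) d (mu t : R)
    (f : 'cV[R]_d -> R) (x y : 'cV[R]_d) :
  strongly_convex mu f -> 0 <= t -> t <= 1 ->
  f (y + t *: (x - y))
    <= f y + t * (f x - f y) - mu / 2 * (t * (1 - t)) * dot (x - y) (x - y).
Proof.
move=> fsc t0 t1.
have := fsc (Itv01 t0 t1) x y; rewrite !inE => /(_ Logic.I Logic.I).
have -> : conv (Itv01 t0 t1) (x : convex_lmodType _) y = y + t *: (x - y).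
  by rewrite /conv /= /unstable.onem scalerBr scalerBl scale1r addrCA.
rewrite convRE /= /unstable.onem !enorm_sqr !dotE (dotC x y).
lra.
Qed.

(** Divide the inequality on the segment by t and let t tend to 0 from the
    right: the quotients tend to the directional derivative. *)
Lemma strongly_convex_lower_bound (R : realType) d (mu : R)
    (f : 'cV[R]_d -> R) (x y : 'cV[R]_d) :
  strongly_convex mu f -> differentiable f y ->
  f y + dot (grad f y) (x - y) + mu / 2 * dot (x - y) (x - y) <= f x.
Proof.
move=> fsc df.
set v := x - y; rewrite dot_grad //.
(* The vanishing summand is the limit of - mu/2 t |v|^2, the part of the bound on
   the quotient that depends on t, moved to the left side. *)
suff : 'D_v f y + - (mu / 2 * dot v v) * 0 <= f x - f y - mu / 2 * dot v v by lra.
have quot : (fun h : R => h^-1 *: ((f \o shift y) (h *: v) - f y)) @ 0^'+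
     --> 'D_v f y.
  by apply: cvg_dnbhs_at_right; exact: diff_derivable.
have lin : (fun h : R => - (mu / 2 * dot v v) * h) @ 0^'+
     --> - (mu / 2 * dot v v) * 0.
  by apply: cvgMr; apply: cvg_at_right_filter; exact: cvg_id.
apply: (cvgr_to_le (cvgD quot lin)).
near=> h.
have h0 : 0 < h by [].
have h1 : h <= 1 by near: h; apply: nbhs_right_le.
have := strongly_convex_segment x y fsc (ltW h0) h1; rewrite -/v (addrC y) => cvx.
change (h^-1 * (f (h *: v + y) - f y) + - (mu / 2 * dot v v) * h
  <= f x - f y - mu / 2 * dot v v).
rewrite -(ler_pM2l h0) mulrDr mulrA divff ?gt_eqF // mul1r.
lra.
Unshelve. all: end_near. Qed.

Lemma smooth_grad_sqr (R : realType) d (L : R) (f : 'cV[R]_d -> R)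
    (x y : 'cV[R]_d) : smooth L f ->
  dot (grad f x - grad f y) (grad f x - grad f y)
    <= L ^+ 2 * dot (x - y) (x - y).
Proof.
move=> [_ _ /(_ x y) lip].
by rewrite -!enorm_sqr -exprMn !expr2 ler_pM ?sqrtr_ge0.
Qed.

(** Descent lemma.  The difference psi of the two sides along the segment from y
    to x has a nonpositive derivative, because the gradient at y + t v differs
    from the one at y by at most L t |v|; the mean value theorem concludes
    without any integral. *)
Lemma smooth_upper_bound (R : realType) d (L : R) (f : 'cV[R]_d -> R)
    (x y : 'cV[R]_d) : 0 < L -> smooth L f ->
  f x <= f y + dot (grad f y) (x - y) + L / 2 * dot (x - y) (x - y).
Proof.
move=> L0 fsm; set v := x - y.
have df : forall z, differentiable f z by case: fsm.
pose psi (t : R) := f (y + t *: v) - (t * dot (grad f y) v + L / 2 * t ^+ 2 * dot v v).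
pose dpsi (t : R) := dot (grad f (y + t *: v)) v - (dot (grad f y) v + L * t * dot v v).
have psi' (t : R) : is_derive t 1 psi (dpsi t).
  apply: is_deriveB; first exact: is_derive_line.
  apply: is_derive_eq.
  change (t * 0 + dot (grad f y) v * 1
    + (L / 2 * t ^+ 2 * 0 + dot v v * (L / 2 * (t * 1 + t * 1)))
    = dot (grad f y) v + L * t * dot v v).
  by field.
have [c /[!in_itv]/= /andP[c0 _] mvt] : exists2 c, c \in `]0, 1[%R &
    psi 1 - psi 0 = dpsi c * (1 - 0).
  apply: MVT => //; apply: continuous_subspaceT => t.
  by apply/differentiable_continuous/derivable1_diffP; have [] := psi' t.
have dpsi_le0 : dpsi c <= 0.
  have Lc : 0 < L * c by rewrite mulr_gt0.
  (* This weight makes both halves of Young's bound at most L c / 2 |v|^2. *)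
  have := dot_young (grad f (y + c *: v) - grad f y) v
    (c := (2 * (L * c))^-1).
  rewrite invr_gt0 pmulr_rgt0 // => /(_ Lc).
  have := smooth_grad_sqr (y + c *: v) y fsm.
  rewrite addrAC subrr add0r !dotZl !dotZr => lip.
  have half : (2 * (L * c))^-1 * dot (grad f (y + c *: v) - grad f y)
      (grad f (y + c *: v) - grad f y) <= L * c / 2 * dot v v.
    apply: le_trans (ler_wpM2l _ lip) _; first by rewrite invr_ge0; lra.
    by rewrite le_eqVlt; apply/orP; left; apply/eqP; field; lra.
  have -> : dot v v / (4 * (2 * (L * c))^-1) = L * c / 2 * dot v v.
    by field; lra.
  rewrite /dpsi (dotDl _ _ v) dotNl; lra.
move: mvt; rewrite /psi scale1r scale0r addr0 /v subrKC -/v; lra.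
Qed.

(** A gradient step of length 1 / L from xs decreases f by at least
    |grad f xs|^2 / (2 L), which minimality forbids unless the gradient is 0. *)
Lemma minimizer_grad0 (R : realType) d (L : R) (f : 'cV[R]_d -> R)
    (xs : 'cV[R]_d) : 0 < L -> smooth L f -> minimizer f xs -> grad f xs = 0.
Proof.
move=> L0 fsm xsm; set g := grad f xs.
have := smooth_upper_bound (xs - L^-1 *: g) xs L0 fsm; rewrite -/g.
have := xsm (xs - L^-1 *: g).
have -> : xs - L^-1 *: g - xs = - (L^-1 *: g) by rewrite addrAC subrr add0r.
rewrite !dotNl !dotNr !dotZl !dotZr.
have -> : L / 2 * - - (L^-1 * (L^-1 * dot g g)) = L^-1 * dot g g / 2.
  by field; rewrite gt_eqF.
move=> h1 h2.
have : L^-1 * dot g g <= 0 by lra.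
rewrite pmulr_rle0 ?invr_gt0 // => h; apply: dot_eq0.
by apply/eqP; rewrite eq_le h dot_ge0.
Qed.

(** Jensen's inequality: average the tangent inequalities taken at the mean
    point, whose linear terms sum to zero. *)
Lemma ergodic_avg_le (R : realType) d (mu : R) (f : 'cV[R]_d -> R)
    (x : int -> 'cV[R]_d) (K : nat) : 0 <= mu -> strongly_convex mu f ->
  (forall z, differentiable f z) ->
  f (ergodic_avg x K) <= (K.+1%:R)^-1 * \sum_(j < K.+1) f (x j%:Z).
Proof.
move=> mu0 fsc df; set z := ergodic_avg x K.
rewrite ler_pdivlMl ?ltr0Sn //.
have -> : K.+1%:R * f z = \sum_(j < K.+1) (f z + dot (grad f z) (x j%:Z - z)).
  rewrite big_split /= sumr_const card_ord mulr_natl.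
  suff -> : \sum_(j < K.+1) dot (grad f z) (x j%:Z - z) = 0 by rewrite addr0.
  rewrite /dot exchange_big big1 //= => i _; rewrite -mulr_sumr.
  suff -> : \sum_(j < K.+1) (x j%:Z - z) i 0 = 0 by rewrite mulr0.
  transitivity ((\sum_(j < K.+1) (x j%:Z - z)) i 0); first by rewrite summxE.
  rewrite sumrB sumr_const card_ord -scaler_nat /z /ergodic_avg scalerA.
  by rewrite divff ?pnatr_eq0 // scale1r subrr mxE.
apply: ler_sum => j _; have := strongly_convex_lower_bound (x j%:Z) fsc (df z).
by apply: le_trans; rewrite lerDl mulr_ge0 ?dot_ge0 // divr_ge0.
Qed.

(** * The Lyapunov function as a squared norm *)

(** Row-major reindexing of the Kronecker product. *)
Lemma sum_mxtens (R : realType) m n (F : 'I_(m * n) -> R) :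
  \sum_k F k = \sum_i \sum_j F (mxtens_index (i, j)).
Proof.
rewrite pair_big /=; rewrite (reindex (@mxtens_index m n)) /=.
  by apply: eq_bigr => -[].
by exists (@mxtens_unindex m n) => i; rewrite (mxtens_indexK, mxtens_unindexK).
Qed.

Lemma stackE (R : realType) d (u v : 'cV[R]_d) (i : 'I_2) (k : 'I_d) :
  stack u v (mxtens_index (i, k)) 0 = if i == 0 then u k 0 else v k 0.
Proof.
rewrite castmxE /= cast_ord_id /=.
case: (eqVneq i 0) => [->|i0].
  have -> : cast_ord (esym (etrans (addnn d) (esym (mul2n d))))
     (mxtens_index (0 : 'I_2, k)) = lshift d k by apply: val_inj.
  by rewrite col_mxEu.
have -> : cast_ord (esym (etrans (addnn d) (esym (mul2n d))))
     (mxtens_index (i, k)) = rshift d k.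
  by apply: val_inj => /=; case: i i0 => -[|[|]] //= _ _; rewrite mul1n.
by rewrite col_mxEd.
Qed.

(** The matrix Ptilde is p p^T / (2 alpha), so the quadratic form of its
    Kronecker product with the identity is the squared norm of the combination
    of the two blocks with coefficients p. *)
Lemma lyapunovE (R : realType) d (f : 'cV[R]_d -> R) (xs : 'cV[R]_d)
    (mu alpha : R) (x0 xm1 : 'cV[R]_d) :
  lyapunov f xs mu alpha x0 xm1 = f x0 - f xs + (2 * alpha)^-1 *
    dot (x0 - xs - (1 - Num.sqrt (alpha * mu)) *: (xm1 - xs))
        (x0 - xs - (1 - Num.sqrt (alpha * mu)) *: (xm1 - xs)).
Proof.
rewrite /lyapunov; set s := Num.sqrt _; set z := stack _ _; congr (_ + _).
pose p (i : 'I_2) : R := if i == 0 then 1 else - (1 - s).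
have PE i j : Ptilde mu alpha i j = (2 * alpha)^-1 * (p i * p j).
  by rewrite !mxE big_ord1 !mxE.
have zP k : \sum_(i < 2) p i * z (mxtens_index (i, k)) 0
    = (x0 - xs - (1 - s) *: (xm1 - xs)) k 0.
  by rewrite !big_ord_recl big_ord0 !stackE /= /p /= !mxE; ring.
rewrite mxE sum_mxtens.
transitivity (\sum_(j < 2) \sum_k \sum_(i < 2) (2 * alpha)^-1 *
  ((p i * z (mxtens_index (i, k)) 0) * (p j * z (mxtens_index (j, k)) 0))).
  apply: eq_bigr => j _; apply: eq_bigr => k _.
  rewrite mxE sum_mxtens mulr_suml; apply: eq_bigr => i _.
  rewrite (bigD1 k) //= big1 => [|l lk].
    by rewrite tensmxE PE !mxE eqxx mulr1; ring.
  by rewrite tensmxE !mxE (negbTE lk) !mulr0.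
rewrite exchange_big /dot mulr_sumr; apply: eq_bigr => k _.
rewrite -zP mulr_suml mulr_sumr exchange_big; apply: eq_bigr => i _ /=.
by rewrite -!mulr_sumr.
Qed.

Lemma lyapunov_ge_gap (R : realType) d (mu alpha : R) (f : 'cV[R]_d -> R)
    (xs x0 xm : 'cV[R]_d) : 0 < alpha ->
  f x0 - f xs <= lyapunov f xs mu alpha x0 xm.
Proof.
move=> al0; rewrite lyapunovE lerDl mulr_ge0 ?dot_ge0 // invr_ge0; lra.
Qed.

(** * One noisy step *)

(** One step in terms of a = y - x_k, b = y - xs, the gradient g at y and the
    noise w; then a + s b is the vector p_k of the Lyapunov function.  The right
    side minus the left side is a combination of the descent inequality and the
    two strong convexity inequalities with weights 1, 1 - s and s, plus the
    nonnegative terms [ha] and [hg]. *)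
Lemma nag_step_expansion (R : realType) d (s alpha mu L fx fy fk fs : R)
    (a b g w q : 'cV[R]_d) :
  q = (1 - s) *: a + s *: b ->
  0 < s -> s <= 1 -> 0 < alpha -> alpha * L <= 1 -> alpha * mu = s ^+ 2 ->
  fx <= fy + dot g (- (alpha *: (g + w)))
    + L / 2 * dot (- (alpha *: (g + w))) (- (alpha *: (g + w))) ->
  fy + dot g (- a) + mu / 2 * dot (- a) (- a) <= fk ->
  fy + dot g (- b) + mu / 2 * dot (- b) (- b) <= fs ->
  fx - fs + (2 * alpha)^-1 * dot (q - alpha *: (g + w)) (q - alpha *: (g + w))
  <= (1 - s) * (fk - fs + (2 * alpha)^-1 * dot (a + s *: b) (a + s *: b))
     - dot q w + alpha ^+ 2 * L * dot g w
     + alpha * (1 + alpha * L) / 2 * dot w w.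
Proof.
move=> qE s0 s1 al0 alL sE desc lbk lbs.
have muE : mu = s ^+ 2 / alpha by rewrite -sE mulrAC mulfV ?mul1r ?gt_eqF.
have ha : 0 <= s * (1 - s ^+ 2) / (2 * alpha) * dot a a.
  rewrite mulr_ge0 ?dot_ge0 // divr_ge0 ?mulr_ge0 //; try lra; nra.
have hg : 0 <= alpha * (1 - alpha * L) / 2 * dot g g.
  by rewrite mulr_ge0 ?dot_ge0 // divr_ge0 ?mulr_ge0 //; lra.
have lbk' : (1 - s) * (fy + dot g (- a) + mu / 2 * dot (- a) (- a))
    <= (1 - s) * fk by rewrite ler_wpM2l //; lra.
have lbs' : s * (fy + dot g (- b) + mu / 2 * dot (- b) (- b)) <= s * fs.
  by rewrite ler_wpM2l //; lra.
rewrite -subr_ge0.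
set RHS := (X in 0 <= X).
suff -> : RHS = (fy + dot g (- (alpha *: (g + w)))
    + L / 2 * dot (- (alpha *: (g + w))) (- (alpha *: (g + w))) - fx)
   + ((1 - s) * fk - (1 - s) * (fy + dot g (- a) + mu / 2 * dot (- a) (- a)))
   + (s * fs - s * (fy + dot g (- b) + mu / 2 * dot (- b) (- b)))
   + s * (1 - s ^+ 2) / (2 * alpha) * dot a a
   + alpha * (1 - alpha * L) / 2 * dot g g by lra.
rewrite /RHS qE !dotE (dotC b a) (dotC g a) (dotC g b) (dotC w a) (dotC w b) (dotC w g) muE.
by field; rewrite gt_eqF.
Qed.

(** The vectors q and b = y - xs are combinations of p and e, so their squared
    norms are controlled by |p|^2 + s^2 |e|^2.  The Young parameters c1 and c2 are
    chosen so that the two cross terms each consume at most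
    s / (8 alpha) (|p|^2 + s^2 |e|^2). *)
Lemma noise_bound (R : realType) d (s alpha L : R) (a b g w p e q : 'cV[R]_d) :
  p = a + s *: b -> e = b - a -> q = (1 - s) *: a + s *: b ->
  0 < s -> 0 < alpha -> 0 < L -> dot g g <= L ^+ 2 * dot b b ->
  - dot q w + alpha ^+ 2 * L * dot g w
  <= s / (4 * alpha) * (dot p p + s ^+ 2 * dot e e)
     + (2 * alpha * (1 + s ^+ 2) / (s * (1 + s) ^+ 2)
        + 2 * alpha ^+ 5 * L ^+ 4 * (1 + s ^+ 2) / (s ^+ 3 * (1 + s) ^+ 2))
       * dot w w.
Proof.
move=> pE eE qE s0 al0 L0 gL.
have s1 : 0 < 1 + s by lra.
have s21 : 0 < 1 + s ^+ 2 by have := exprn_gt0 2 s0; lra.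
pose c1 := s * (1 + s) ^+ 2 / (8 * alpha * (1 + s ^+ 2)).
pose c2 := s ^+ 3 * (1 + s) ^+ 2 / (8 * alpha * L ^+ 2 * (1 + s ^+ 2)).
have c10 : 0 < c1 by rewrite divr_gt0 ?mulr_gt0 ?exprn_gt0.
have c20 : 0 < c2 by rewrite divr_gt0 ?mulr_gt0 ?exprn_gt0.
have qpe : (1 + s) *: q = p + s ^+ 2 *: e.
  by apply/colP => i; rewrite qE pE eE !mxE; ring.
have bpe : (1 + s) *: b = p + 1 *: e.
  by apply/colP => i; rewrite pE eE !mxE; ring.
have Q : c1 * dot q q <= s / (8 * alpha) * (dot p p + s ^+ 2 * dot e e).
  (* Weight s^2: the coefficient of |e|^2 becomes (1 + s^-2) s^4 = (1 + s^2) s^2. *)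
  have := dot_lincomb_le (s ^+ 2) p e (exprn_gt0 2 s0).
  rewrite -qpe dotZl dotZr => h.
  have k0 : 0 < s / (8 * alpha * (1 + s ^+ 2)) by rewrite divr_gt0 ?mulr_gt0.
  have := ler_wpM2l (ltW k0) h; congr (_ <= _).
    by rewrite /c1; ring.
  by field; rewrite !gt_eqF.
have B : c2 * dot g g <= s / (8 * alpha) * (dot p p + s ^+ 2 * dot e e).
  apply: le_trans (ler_wpM2l (ltW c20) gL) _.
  (* Weight s^-2: the coefficients become (1 + s^2) / s^2 and 1 + s^2. *)
  have s20 : 0 < s ^- 2 by rewrite invr_gt0 exprn_gt0.
  have := dot_lincomb_le 1 p e s20.
  rewrite -bpe dotZl dotZr => h.
  have k0 : 0 < s ^+ 3 / (8 * alpha * (1 + s ^+ 2)).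
    by rewrite divr_gt0 ?mulr_gt0 ?exprn_gt0.
  have := ler_wpM2l (ltW k0) h; congr (_ <= _).
    by rewrite /c2; field; rewrite !gt_eqF.
  by field; rewrite !gt_eqF.
have := dot_young q (- w) c10.
have := dot_young g ((alpha ^+ 2 * L) *: w) c20.
rewrite !dotNl !dotNr !dotZl !dotZr opprK => Y2 Y1.
set W := dot w w in Y1 Y2 *.
have -> : (2 * alpha * (1 + s ^+ 2) / (s * (1 + s) ^+ 2)
        + 2 * alpha ^+ 5 * L ^+ 4 * (1 + s ^+ 2) / (s ^+ 3 * (1 + s) ^+ 2)) * W
  = W / (4 * c1) + alpha ^+ 2 * L * (alpha ^+ 2 * L * W) / (4 * c2).
  by rewrite /c1 /c2; field; rewrite !gt_eqF.
have -> : s / (4 * alpha) = s / (8 * alpha) + s / (8 * alpha).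
  by field; rewrite gt_eqF.
lra.
Qed.

(** All occurrences of mu are eliminated through mu = s^2 / alpha; note that
    5 - 2 s + s^2 = 4 + (1 - s)^2. *)
Lemma Lbar_NAG_sqr (R : realType) (mu L alpha : R) :
  0 < mu -> 0 < L -> 0 < alpha -> let s := Num.sqrt (alpha * mu) in
  Lbar_NAG mu L alpha ^+ 2
  = 4 * alpha * (4 + (1 - s) ^+ 2) / (s * (1 + s)) ^+ 2
    + alpha * (1 + alpha * L) / s
    + 8 * alpha ^+ 5 * L ^+ 4 * (4 + (1 - s) ^+ 2) / (s ^+ 2 * (1 + s)) ^+ 2.
Proof.
move=> mu0 L0 al0; lazy zeta; rewrite /Lbar_NAG; set s := Num.sqrt (alpha * mu).
have s0 : 0 < s by rewrite sqrtr_gt0 mulr_gt0.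
have sE : alpha * mu = s ^+ 2 by rewrite sqr_sqrtr // ltW // mulr_gt0.
have muE : mu = s ^+ 2 / alpha by rewrite -sE mulrAC mulfV ?mul1r ?gt_eqF.
have sqE : Num.sqrt alpha / Num.sqrt mu = alpha / s.
  rewrite /s sqrtrM ?ltW // -[X in _ = X / _](sqr_sqrtr (ltW al0)).
  by field; rewrite !gt_eqF ?sqrtr_gt0.
have N0 : 0 < 4 + (1 - s) ^+ 2 by have := sqr_ge0 (1 - s); lra.
rewrite sE (mulrAC (Num.sqrt alpha)) sqE.
have -> : 5 - 2 * s + s ^+ 2 = 4 + (1 - s) ^+ 2 by ring.
move: (4 + (1 - s) ^+ 2) N0 => N N0.
rewrite sqr_sqrtr; last first.
  by rewrite !addr_ge0 ?divr_ge0 ?mulr_ge0 ?invr_ge0 ?exprn_ge0 ?addr_ge0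
    ?mulr_ge0 ?exprn_ge0 ?addr_ge0 ?ler01 ?ltW.
by rewrite muE; field; rewrite !gt_eqF //; lra.
Qed.

(** After multiplication by s / 2, the middle term of the square of Lbar_NAG is
    exactly the last term of the left side.  The other two terms compare because
    1 + s^2 <= 4 + (1 - s)^2 for s <= 1. *)
Lemma noise_coefficient_le (R : realType) (mu L alpha : R) :
  0 < mu -> 0 < L -> 0 < alpha ->
  forall s, s = Num.sqrt (alpha * mu) -> s <= 1 ->
  2 * alpha * (1 + s ^+ 2) / (s * (1 + s) ^+ 2)
  + 2 * alpha ^+ 5 * L ^+ 4 * (1 + s ^+ 2) / (s ^+ 3 * (1 + s) ^+ 2)
  + alpha * (1 + alpha * L) / 2
  <= s / 2 * Lbar_NAG mu L alpha ^+ 2.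
Proof.
move=> mu0 L0 al0 s sE s1.
have s0 : 0 < s by rewrite sE sqrtr_gt0 mulr_gt0.
rewrite Lbar_NAG_sqr // -sE -subr_ge0; set D := (X in 0 <= X).
have -> : D = (4 + (1 - s) ^+ 2 - (1 + s ^+ 2))
      * (2 * alpha / (s * (1 + s) ^+ 2)
         + 2 * alpha ^+ 5 * L ^+ 4 / (s ^+ 3 * (1 + s) ^+ 2))
    + 2 * alpha ^+ 5 * L ^+ 4 * (4 + (1 - s) ^+ 2) / (s ^+ 3 * (1 + s) ^+ 2).
  by rewrite /D; field; rewrite !gt_eqF //; lra.
have [s0' al0' L0'] : [/\ 0 <= s, 0 <= alpha & 0 <= L] by rewrite !ltW.
have N0 : 0 <= 4 + (1 - s) ^+ 2 - (1 + s ^+ 2) by rewrite !expr2; lra.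
have N1 : 0 <= 4 + (1 - s) ^+ 2 by have := sqr_ge0 (1 - s); lra.
have s1' : 0 <= 1 + s by rewrite addr_ge0.
apply: addr_ge0; last by rewrite divr_ge0 ?mulr_ge0 ?exprn_ge0.
by apply: mulr_ge0 => //; apply: addr_ge0; rewrite divr_ge0 ?mulr_ge0 ?exprn_ge0.
Qed.

Lemma sqrt_step_le1 (R : realType) (mu L alpha : R) :
  0 < mu -> mu < L -> 0 < alpha -> alpha <= 1 / L -> Num.sqrt (alpha * mu) <= 1.
Proof.
move=> mu0 muL al0 alL; rewrite -[leRHS]sqrtr1 ler_wsqrtr //.
have L0 : 0 < L := lt_trans mu0 muL.
apply: le_trans (_ : alpha * L <= 1); last by rewrite -ler_pdivlMr.
by rewrite ler_wpM2l ?ltW.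
Qed.

(** Half of the contraction rate s pays for the noise: quadratic growth of f
    around xs gives (|p|^2 + s^2 |e|^2) / (2 alpha) <= V_k. *)
Lemma nag_lyapunov_step (R : realType) d (mu L alpha : R) (f : 'cV[R]_d -> R)
    (xs xk xm w : 'cV[R]_d) :
  0 < mu -> mu < L -> strongly_convex mu f -> smooth L f -> minimizer f xs ->
  0 < alpha -> alpha <= 1 / L ->
  let y := xk + nag_beta mu alpha *: (xk - xm) in
  lyapunov f xs mu alpha (y - alpha *: (grad f y + w)) xk
  <= (1 - Num.sqrt (alpha * mu) / 2) * lyapunov f xs mu alpha xk xm
     + Num.sqrt (alpha * mu) / 2 * Lbar_NAG mu L alpha ^+ 2 * dot w w.
Proof.
move=> mu0 muL fsc fsm xsm al0 alL; cbv zeta.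
set y := xk + _; set g := grad f y.
have L0 : 0 < L by lra.
have df : forall z, differentiable f z by case: fsm.
have alL1 : alpha * L <= 1 by rewrite -ler_pdivlMr.
rewrite !lyapunovE.
set s := Num.sqrt (alpha * mu).
have s0 : 0 < s by rewrite sqrtr_gt0 mulr_gt0.
have sE : alpha * mu = s ^+ 2 by rewrite sqr_sqrtr // ltW // mulr_gt0.
have s1 : s <= 1 := sqrt_step_le1 mu0 muL al0 alL.
pose a := y - xk; pose b := y - xs; pose p := a + s *: b; pose e := b - a.
pose q := (1 - s) *: a + s *: b.
(* With beta = (1 - s) / (1 + s), the point (1 + s) y has coefficients free of
   quotients, which identifies p_k with a + s b. *)
have yE : (1 + s) *: y = 2 *: xk - (1 - s) *: xm.
  rewrite /y /nag_beta -/s scalerDr scalerA (mulrC (1 + s)) divfK; last by lra.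
  by apply/colP => i; rewrite !mxE; ring.
have pE : xk - xs - (1 - s) *: (xm - xs) = p.
  have -> : p = (1 + s) *: y - xk - s *: xs.
    by apply/colP => i; rewrite !mxE; ring.
  by rewrite yE; apply/colP => i; rewrite !mxE; ring.
have qE : y - alpha *: (g + w) - xs - (1 - s) *: (xk - xs)
    = q - alpha *: (g + w).
  by apply/colP => i; rewrite !mxE; ring.
have eE : xk - xs = e by apply/colP => i; rewrite !mxE; ring.
have gs0 := minimizer_grad0 L0 fsm xsm.
have gL : dot g g <= L ^+ 2 * dot b b.
  by have := smooth_grad_sqr y xs fsm; rewrite gs0 subr0.
have desc := smooth_upper_bound (y - alpha *: (g + w)) y L0 fsm.
have lbk := strongly_convex_lower_bound xk fsc (df y).
have lbs := strongly_convex_lower_bound xs fsc (df y).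
have growth := strongly_convex_lower_bound xk fsc (df xs).
rewrite gs0 eE (_ : dot 0 e = 0) ?addr0 in growth; last first.
  by rewrite -(scale0r (0 : 'cV[R]_d)) dotZl mul0r.
have yx : y - alpha *: (g + w) - y = - (alpha *: (g + w)).
  by rewrite addrAC subrr add0r.
rewrite yx -(opprB y xk) -/a -/g in desc lbk.
rewrite -(opprB y xs) -/b -/g in lbs.
have := nag_step_expansion (erefl q) s0 s1 al0 alL1 sE desc lbk lbs.
have := noise_bound w (erefl p) (erefl e) (erefl q) s0 al0 L0 gL.
have := ler_wpM2r (dot_ge0 w) (noise_coefficient_le mu0 L0 al0 (erefl s) s1).
rewrite pE qE.
set C1 := _ / _ + _ / _; set Lb := Lbar_NAG _ _ _ ^+ 2; set P := dot p p.
set E := dot e e in growth *; set W := dot w w => cW nW main.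
have V0 : s / (4 * alpha) * (P + s ^+ 2 * E)
    <= s / 2 * (f xk - f xs + (2 * alpha)^-1 * P).
  have -> : s / (4 * alpha) * (P + s ^+ 2 * E)
      = s / 2 * (mu / 2 * E + (2 * alpha)^-1 * P).
    by rewrite -sE; field; rewrite gt_eqF.
  by rewrite ler_wpM2l ?divr_ge0 ?(ltW s0) //; lra.
lra.
Qed.

(** * Summation over the iterations *)

(** Telescoping rather than unrolling the recursion: this is what turns a
    contraction into a bound on the sum of the V_j. *)
Lemma sum_perturbed_contraction (R : realType) (rho : R) (V n : nat -> R)
    (K : nat) :
  (forall k, V k.+1 <= (1 - rho) * V k + n k) ->
  V K.+1 + rho * \sum_(j < K.+1) V j <= V 0%N + \sum_(j < K.+1) n j.
Proof.
move=> step; elim: K => [|K IH].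
  by rewrite !big_ord_recr !big_ord0 /=; have := step 0%N; lra.
by rewrite big_ord_recr [in leRHS]big_ord_recr /=; have := step K.+1; lra.
Qed.

Lemma Hbar_ge (R : realType) (mu alpha V0 : R) : 0 < mu -> 0 < alpha ->
  Num.sqrt (alpha * mu) <= 1 -> 0 <= V0 ->
  2 / Num.sqrt (alpha * mu) * V0 <= Hbar mu alpha V0.
Proof.
move=> mu0 al0; rewrite /Hbar; set s := Num.sqrt (alpha * mu) => s1 V00.
have sE : alpha * mu = s ^+ 2 by rewrite sqr_sqrtr // ltW // mulr_gt0.
have s0 : 0 <= s by rewrite sqrtr_ge0.
have t0 : 0 <= 1 - s by lra.
have N0 : 0 <= 4 + (1 - s) ^+ 2 by have := sqr_ge0 (1 - s); lra.
rewrite sE (_ : 5 - 2 * s + s ^+ 2 = 4 + (1 - s) ^+ 2); last by ring.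
rewrite ler_wpM2r // ler_peMr ?divr_ge0 // -addrA lerDl.
by rewrite addr_ge0 // divr_ge0 ?mulr_ge0 ?exprn_ge0.
Qed.

Theorem corollary5p4 (R : realType) (d : nat) (mu L : R)
    (mu_gt0 : 0 < mu) (mu_lt_L : mu < L)
    (f : 'cV[R]_d -> R)
    (f_sc : strongly_convex mu f) (f_smooth : smooth L f)
    (xs : 'cV[R]_d) (xs_min : minimizer f xs)
    (alpha : R) (alpha_gt0 : 0 < alpha) (alpha_le : alpha <= 1 / L)
    (w : nat -> 'cV[R]_d) (x : int -> 'cV[R]_d)
    (x_nag : noisy_nag f alpha (nag_beta mu alpha) w x)
    (x_init : x 0 = x (- 1))
    (K : nat) :
  f (ergodic_avg x K) - f xs
    <= (K.+1%:R)^-1 * (\sum_(j < K.+1) (f (x j%:Z) - f xs))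
    <= Lbar_NAG mu L alpha ^+ 2
         * ((\sum_(j < K.+1) enorm (w j) ^+ 2) / K.+1%:R)
       + Hbar mu alpha (lyapunov f xs mu alpha (x 0) (x (- 1))) / K.+1%:R
       - 2 / Num.sqrt (alpha * mu)
         * ((f (x K.+1%:Z) - f xs) / K.+1%:R).
Proof.
have df : forall z, differentiable f z by case: f_smooth.
have n0 : 0 < K.+1%:R :> R by rewrite ltr0Sn.
apply/andP; split.
  rewrite sumrB sumr_const card_ord mulrBr -[f xs *+ _]mulr_natl mulKf ?gt_eqF //.
  by rewrite lerD2r (ergodic_avg_le _ _ (ltW mu_gt0)).
pose V (k : nat) := lyapunov f xs mu alpha (x k%:Z) (x (k%:Z - 1)).
set s := Num.sqrt (alpha * mu).
have s0 : 0 < s by rewrite sqrtr_gt0 mulr_gt0.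
have s1 : s <= 1 := sqrt_step_le1 mu_gt0 mu_lt_L alpha_gt0 alpha_le.
set Lb := Lbar_NAG mu L alpha ^+ 2.
have step k : V k.+1 <= (1 - s / 2) * V k + s / 2 * Lb * dot (w k) (w k).
  have -> : V k.+1 = lyapunov f xs mu alpha (x (k%:Z + 1)) (x k%:Z).
    by rewrite /V -addn1 PoszD addrK.
  rewrite x_nag addrAC.
  exact: nag_lyapunov_step.
have := sum_perturbed_contraction K step.
rewrite -mulr_sumr => total.
have last_le : f (x K.+1%:Z) - f xs <= V K.+1 by exact: lyapunov_ge_gap.
have sum_le : \sum_(j < K.+1) (f (x j%:Z) - f xs) <= \sum_(j < K.+1) V j.
  by apply: ler_sum => j _; exact: lyapunov_ge_gap.
have V00 : 0 <= V 0%N.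
  by apply: le_trans (lyapunov_ge_gap _ _ _ _ _ alpha_gt0); rewrite subr_ge0.
have H := Hbar_ge mu_gt0 alpha_gt0 s1 V00.
rewrite (_ : lyapunov f xs mu alpha (x 0) (x (- 1)) = V 0%N); last by rewrite /V sub0r.
rewrite -/s in H.
rewrite ler_pdivrMl //.
under [in leRHS]eq_bigr do rewrite enorm_sqr.
set W := \sum_(j < K.+1) dot _ _ in total *.
set S := \sum_(j < K.+1) (f _ - _) in sum_le *.
set T := \sum_(j < K.+1) V j in total sum_le.
set dK := f _ - f xs in last_le *.
have -> : K.+1%:R * (Lb * (W / K.+1%:R) + Hbar mu alpha (V 0%N) / K.+1%:R
    - 2 / s * (dK / K.+1%:R)) = Lb * W + Hbar mu alpha (V 0%N) - 2 / s * dK.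
  by field; rewrite !gt_eqF.
have unscale u z : 2 / s * (u + s / 2 * z) = 2 / s * u + z.
  by field; rewrite gt_eqF.
have : 2 / s * (dK + s / 2 * S) <= 2 / s * (V 0%N + s / 2 * (Lb * W)).
  have sS : s / 2 * S <= s / 2 * T by rewrite ler_wpM2l //; lra.
  by rewrite ler_wpM2l ?divr_ge0 ?(ltW s0) //; lra.
rewrite !unscale; lra.
Qed.
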